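(* Let $\alpha$ be an algebraic number of degree $8$ over $\mathbb{Q}$ with algebraic conjugates $\alpha_1=\alpha,\alpha_2,\dots,\alpha_8$. Suppose that the minimal polynomial of $\alpha$ over $\mathbb{Q}$ is not an even polynomial and that $\alpha$ possesses exactly six distinct linear relations of the form $\alpha_{i_1}+\alpha_{i_2}+\alpha_{i_3}+\alpha_{i_4}=0$. Then $\alpha$ is a sum of a quadratic algebraic number and a quartic algebraic number.
   Context: The algebraic conjugates of $\alpha$ are the complex roots of its minimal polynomial over $\mathbb{Q}$. Relations $\alpha_{i_1}+\alpha_{i_2}+\alpha_{i_3}+\alpha_{i_4}=0$ are considered only for four distinct algebraic conjugates $\alpha_{i_1},\alpha_{i_2},\alpha_{i_3},\alpha_{i_4}$ of $\alpha$. Two such relations $\alpha_{i_1}+\alpha_{i_2}+\alpha_{i_3}+\alpha_{i_4}=0$ and $\alpha_{j_1}+\alpha_{j_2}+\alpha_{j_3}+\alpha_{j_4}=0$ are distinct if $\{\alpha_{i_1},\alpha_{i_2},\alpha_{i_3},\alpha_{i_4}\}\neq\{\alpha_{j_1},\alpha_{j_2},\alpha_{j_3},\alpha_{j_4}\}$. A polynomial $p(x)$ is even if $p(-x)=p(x)$. A quadratic (respectively quartic) algebraic number is an algebraic number of degree $2$ (respectively $4$) over $\mathbb{Q}$. *)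

(* Defs.v *)
From HB Require Import structures.
From mathcomp Require Import all_boot all_order all_algebra all_field.

Set Implicit Arguments.
Unset Strict Implicit.
Unset Printing Implicit Defensive.

Import Order.TTheory GRing.Theory Num.Theory.
Local Open Scope ring_scope.

(* minCpoly x is the minimal polynomial of x over the rationals, with its
   coefficients embedded in algC. *)
Definition alg_degree (x : algC) : nat := (size (minCpoly x)).-1.

Definition is_even_poly (p : {poly algC}) : Prop := p \Po (- 'X) = p.

Definition conjugates_of (n : nat) (x : algC) (a : 'I_n -> algC) : Prop :=
  injective a /\ (forall y : algC, root (minCpoly x) y <-> exists i, a i = y).

(* The relations a_i1 + a_i2 + a_i3 + a_i4 = 0 between four distinct
   conjugates, each identified with its index set {i1, i2, i3, i4}.  When a is
   injective, two index sets are equal iff the corresponding sets of values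
   are, so this counts relations up to equality of the sets of conjugates. *)
Definition four_term_relations (n : nat) (a : 'I_n -> algC) : {set {set 'I_n}} :=
  [set S : {set 'I_n} | (#|S| == 4) && (\sum_(i in S) a i == 0)].

(* Main.v *)
Require Import Defs.
From HB Require Import structures.
From mathcomp Require Import all_boot all_order all_algebra all_field.
From mathcomp Require Import ring zify.

Set Implicit Arguments.
Unset Strict Implicit.
Unset Printing Implicit Defensive.

Import Order.TTheory GRing.Theory Num.Theory.
Local Open Scope ring_scope.

(* The six relations are permuted by the Galois group, which is transitive on the
   conjugates, so double counting gives trace zero and the relations come in
   complementary pairs {A, ~A}, {B, ~B}, {C, ~C}; distinct conjugates force
   |A & B| = |A & C| = |B & C| = 2.  Either |A & B & C| = 2, and then this pair
   of conjugates has sum zero, which makes the minimal polynomial even; or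
   membership in A, B, C labels the conjugates by the vertices of a cube all of
   whose facets have sum zero.  Let alpha' be the conjugate antipodal to alpha.
   Antipodality is Galois invariant, (alpha - alpha') / 2 is determined up to
   sign by the facet equations, and (alpha + alpha') / 2 has at most one
   conjugate for each of the four diagonals.  The degrees 2 and 4 are attained
   because their product must be at least 8. *)

(** * Minimal polynomials and automorphisms of [algC] *)

Lemma minCpoly_roots (x : algC) :
  {r : seq algC | minCpoly x = \prod_(z <- r) ('X - z%:P) & uniq r}.
Proof.
have [p [Dp mon_p] dv_p] := minCpolyP x.
have [r Dr] := closed_field_poly_normal (minCpoly x).
rewrite (monicP (minCpoly_monic x)) scale1r in Dr.
exists r => //; rewrite -separable_prod_XsubC -Dr Dp.
rewrite separable_map.
have nz_p := monic_neq0 mon_p; have px : root (map_poly ratr p) x by rewrite dv_p.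
set g := gcdp p p^`().
have g_p : g %| p := dvdp_gcdl _ _.
(* It suffices that [p] divides its separable quotient [p %/ g], that is, that [x] is a root of this
   quotient. Otherwise [x] is a root of [g], and [p] divides its own derivative. *)
apply: dvdp_separable (make_separable nz_p); rewrite -dv_p.
move: px; rewrite -{1}(divpK g_p) rmorphM rootM => /orP[] //.
move=> gx; have p_g : p %| g by rewrite -dv_p.
have: p %| p^`() := dvdp_trans p_g (dvdp_gcdr _ _).
have p_gt1 : (1 < size p)%N by rewrite -(size_map_poly (@ratr algC)) -Dp size_minCpoly.
have ltp' : (size p^`() < size p)%N := lt_size_deriv nz_p.
move/dvdp_leq; rewrite leqNgt ltp' => /(_ _)/negP; case=> //.
(* The derivative is nonzero in characteristic 0: its coefficient of index [(size p).-2] is the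
   leading coefficient of [p] times its degree. *)
have Dn : (size p).-2.+1 = (size p).-1 by case: (size p) p_gt1 => [|[]].
apply/eqP=> /(congr1 (coefp (size p).-2)); rewrite /= coef_deriv coef0 Dn => /eqP.
by rewrite mulrn_eq0 -lead_coefE lead_coef_eq0 (negPf nz_p) -Dn.
Qed.


(** The embedding of Q([x]) sending [x] to [y] extends to the number field [L] generated by all
    conjugates, a splitting field of [p], and then from [L] to [algC]. *)
Lemma conj_aut (x y : algC) :
  root (minCpoly x) y -> {nu : {rmorphism algC -> algC} | nu x = y}.
Proof.
move=> py0; have [p [Dp mon_p] dv_p] := minCpolyP x.
have [r Dr] := closed_field_poly_normal (minCpoly x).
rewrite (monicP (minCpoly_monic x)) scale1r in Dr.
have rx : x \in r by rewrite -root_prod_XsubC -Dr root_minCpoly.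
have ry : y \in r by rewrite -root_prod_XsubC -Dr.
have [L [LC [rr Drr genL]]] := num_field_exists r.
have [x1 rx1 Dx] : {x1 | x1 \in rr & x = LC x1}.
  by move: rx; rewrite -Drr => /mapP/sig2_eqW.
have [y1 ry1 Dy] : {y1 | y1 \in rr & y = LC y1}.
  by move: ry; rewrite -Drr => /mapP/sig2_eqW.
have LCQ q : map_poly LC (map_poly (in_alg L) q) = map_poly ratr q.
  by rewrite -map_poly_comp; apply: eq_map_poly => b /=; rewrite alg_num_field fmorph_rat.
pose pL := map_poly (in_alg L) p.
have pL1 : pL \is a polyOver 1%VS by apply/polyOver1P; exists p.
have splL : splittingFieldFor 1 pL {:L}.
  exists rr => //; suff -> : pL = \prod_(z <- rr) ('X - z%:P) by apply: eqpxx.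
  apply: (map_poly_inj LC); rewrite LCQ -Dp Dr -Drr big_map rmorph_prod.
  by apply: eq_bigr => z _; rewrite rmorphB /= map_polyX map_polyC.
pose f := kHomExtend 1 \1 x1 y1.
have y1root : root (map_poly \1%VF (minPoly 1 x1)) y1.
  rewrite lfun1_poly.
  have /polyOver1P[q Dq] := minPolyOver 1 x1.
  have: root (minPoly 1 x1) x1 := root_minPoly _ _.
  rewrite Dq -!(fmorph_root LC) LCQ -Dx -Dy dv_p.
  by case/dvdpP=> t ->; rewrite rmorphM rootM /= -Dp py0 orbT.
have homf : kHom 1 <<1; x1>> f.
  by apply: kHomExtendP (kHom1 1 1) y1root; exact: subvv.
have fx : f x1 = y1 by exact: kHomExtend_val (kHom1 1 1) y1root.
have [g homg fg] := kHom_extends (sub1v _) homf pL1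
  (splittingFieldForS (sub1v _) (subvf _) splL).
have gM : monoid_morphism g by apply/kHom_monoid_morphism; apply: homg.
pose gRM := GRing.isMonoidMorphism.Build _ _ g gM.
pose gR : {rmorphism L -> L} := HB.pack (fun_of_lfun g) gRM.
have [nu Dnu] := extend_algC_subfield_aut LC gR.
by exists nu; rewrite Dx -Dnu /= -fg ?fx ?memv_adjoin.
Qed.


Lemma root_minCpoly_aut (nu : {rmorphism algC -> algC}) (x : algC) :
  root (minCpoly x) (nu x).
Proof. by rewrite -(minCpoly_aut nu) root_minCpoly. Qed.

(** Since the minimal polynomial has simple roots, all of them automorphic images of [x], bounding
    the orbit bounds the degree. *)
Lemma alg_degree_le_orbit (x : algC) (s : seq algC) :
  (forall nu : {rmorphism algC -> algC}, nu x \in s) -> (alg_degree x <= size s)%N.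
Proof.
move=> xs; have [r Dr Ur] := minCpoly_roots x.
rewrite /alg_degree Dr size_prod_XsubC; apply: uniq_leq_size => // y.
by rewrite -root_prod_XsubC -Dr => /conj_aut[nu <-].
Qed.

Lemma alg_degree_add (x y : algC) :
  (alg_degree (x + y)%R <= alg_degree x * alg_degree y)%N.
Proof.
have [[r Dr _] [s Ds _]] := (minCpoly_roots x, minCpoly_roots y).
rewrite /alg_degree Dr Ds !size_prod_XsubC /=.
rewrite -(size_allpairs +%R); apply: alg_degree_le_orbit => nu.
rewrite rmorphD; apply: allpairs_f.
  by rewrite -root_prod_XsubC -Dr root_minCpoly_aut.
by rewrite -root_prod_XsubC -Ds root_minCpoly_aut.
Qed.

(** Composition with [- 'X] gives a polynomial that vanishes at [x], has the same degree and, that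
    degree being even, is still monic; minimality forces equality. *)
Lemma even_minCpoly (x : algC) :
  ~~ odd (alg_degree x) -> root (minCpoly x) (- x) -> is_even_poly (minCpoly x).
Proof.
rewrite /alg_degree /is_even_poly => even_n Nx.
have [p [Dp mon_p] dv_p] := minCpolyP x.
have sz2 : size (- 'X : {poly algC}) = 2%N by rewrite size_polyN size_polyX.
have Dq : minCpoly x \Po - 'X = map_poly ratr (p \Po - 'X).
  by rewrite Dp map_comp_poly rmorphN /= map_polyX.
have p_q : minCpoly x %| minCpoly x \Po - 'X.
  by rewrite Dq Dp dvdp_map -dv_p -Dq /root horner_comp !hornerE.
apply/esym/eqP; rewrite -eqp_monic ?minCpoly_monic //.
  by rewrite -dvdp_size_eqp // size_comp_poly2.
rewrite monicE lead_coef_comp ?sz2 // lead_coefN lead_coefX.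
by rewrite -signr_odd (negPf even_n) expr0 mulr1 -monicE minCpoly_monic.
Qed.

(** * Splitting sums over the eight cells cut out by three sets *)

Section Cells.

Variables (T : finType) (A B C : {set T}).

Definition in_cell (x y z : bool) (i : T) : bool :=
  [&& (i \in A) == x, (i \in B) == y & (i \in C) == z].

Section BigCell.

Variables (V : Type) (idx : V) (op : Monoid.com_law idx) (w : T -> V).

Local Notation c x y z := (\big[op/idx]_(i | in_cell x y z i) w i).

(** Cells are the vertices of a cube; edges and facets split into them. The law is arbitrary so that
    the same identities count indices in [nat] and add conjugates in [algC]. *)
Lemma big_cellAB (x y : bool) :
  \big[op/idx]_(i | ((i \in A) == x) && ((i \in B) == y)) w i =
    op (c x y true) (c x y false).
Proof.
rewrite (bigID (mem C)); congr (op _ _); apply: eq_bigl => i;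
  by rewrite /in_cell /=; case: (i \in C); rewrite ?andbT ?andbF.
Qed.

Lemma big_cellBC (y z : bool) :
  \big[op/idx]_(i | ((i \in B) == y) && ((i \in C) == z)) w i =
    op (c true y z) (c false y z).
Proof.
rewrite (bigID (mem A)); congr (op _ _); apply: eq_bigl => i;
  by rewrite /in_cell /=; case: (i \in A); rewrite ?andbT ?andbF.
Qed.

Lemma big_cellAC (x z : bool) :
  \big[op/idx]_(i | ((i \in A) == x) && ((i \in C) == z)) w i =
    op (c x true z) (c x false z).
Proof.
rewrite (bigID (mem B)); congr (op _ _); apply: eq_bigl => i;
  by rewrite /in_cell /=; case: (i \in B); rewrite ?andbT ?andbF.
Qed.

Lemma big_split_mem (S : {set T}) (P : pred T) :
  \big[op/idx]_(i | P i) w i =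
    op (\big[op/idx]_(i | P i && ((i \in S) == true)) w i)
       (\big[op/idx]_(i | P i && ((i \in S) == false)) w i).
Proof.
by rewrite (bigID (mem S)); congr (op _ _); apply: eq_bigl => i /=; case: (i \in S).
Qed.

Lemma big_cellA (x : bool) :
  \big[op/idx]_(i | (i \in A) == x) w i =
    op (op (c x true true) (c x true false)) (op (c x false true) (c x false false)).
Proof. by rewrite (big_split_mem B) !big_cellAB. Qed.

Lemma big_cellB (y : bool) :
  \big[op/idx]_(i | (i \in B) == y) w i =
    op (op (c true y true) (c false y true)) (op (c true y false) (c false y false)).
Proof. by rewrite (big_split_mem C) !big_cellBC. Qed.

Lemma big_cellC (z : bool) :
  \big[op/idx]_(i | (i \in C) == z) w i =
    op (op (c true true z) (c true false z)) (op (c false true z) (c false false z)).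
Proof.
rewrite (big_split_mem A); congr (op _ _); rewrite -big_cellAC;
  by apply: eq_bigl => i; rewrite andbC.
Qed.

End BigCell.

End Cells.

(** * Combinatorics of the relations among eight conjugates *)

Section FourTermRelations.

Variable a : 'I_8 -> algC.
Hypothesis inj_a : injective a.

Local Notation F := (four_term_relations a).

Lemma four_term_relationsP (S : {set 'I_8}) :
  reflect (#|S| = 4%N /\ \sum_(i in S) a i = 0) (S \in F).
Proof. by rewrite inE; apply: (iffP andP) => -[/eqP ? /eqP ?]. Qed.

(** By transitivity every index lies in the same number of relations, which is positive; adding up
    all relations gives that multiple of the trace. *)
Lemma trace_zero :
    (forall i j, exists s : 'I_8 -> 'I_8,
      [/\ injective s, s i = j & forall S, S \in F -> s @: S \in F]) ->
  F != set0 -> \sum_i a i = 0.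
Proof.
move=> transF /set0Pn[S0 FS0].
pose r i := #|[set S in F | i \in S]|.
have le_r i j : (r i <= r j)%N.
  have [s [inj_s <- Fs]] := transF i j.
  rewrite /r -(card_imset _ (imset_inj inj_s)); apply: subset_leq_card.
  apply/subsetP=> _ /imsetP[S /setIdP[FS iS] ->].
  by rewrite inE Fs // imset_f.
have eq_r i : r i = r ord0 by apply/eqP; rewrite eqn_leq !le_r.
have: \sum_(S in F) \sum_(i in S) a i = 0.
  by apply: big1 => S /four_term_relationsP[].
rewrite (exchange_big_dep predT) //=.
have -> : \sum_i \sum_(S in F | i \in S) a i = (\sum_i a i) *+ r ord0.
  rewrite -sumrMnl; apply: eq_bigr => i _.
  by rewrite sumr_const -(eq_r i) /r; congr (_ *+ _); apply: eq_card => S; rewrite inE.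
move/eqP; rewrite mulrn_eq0 => /orP[r0 | /eqP //].
have [cS0 _] := four_term_relationsP _ FS0.
have [i iS0] : exists i, i \in S0 by apply/set0Pn; rewrite -card_gt0 cS0.
have: S0 \in [set S in F | i \in S] by apply/setIdP.
by move: r0; rewrite -(eq_r i) cards_eq0 => /eqP ->; rewrite inE.
Qed.

Hypothesis sum_a : \sum_i a i = 0.

Lemma relation_setC (S : {set 'I_8}) : S \in F -> ~: S \in F.
Proof.
case/four_term_relationsP=> cS sS; apply/four_term_relationsP; split.
  by rewrite cardsCs setCK cS card_ord.
move: sum_a; rewrite (bigID (mem S)) /= sS add0r => sSC.
by rewrite -[RHS]sSC; apply: eq_bigl => i; rewrite inE.
Qed.

(* Two relations with three common terms would force their fourth terms to agree. *)
Lemma card_relationI_neq3 (S S' : {set 'I_8}) :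
  S \in F -> S' \in F -> #|S :&: S'| <> 3%N.
Proof.
move=> /four_term_relationsP[cS sS] /four_term_relationsP[cS' sS'] c3.
have := cardsID S' S; have := cardsID S S'.
rewrite [S' :&: S]setIC c3 cS cS'.
move=> cy cx; have /eqP/cards1P[y Dy] : #|S' :\: S| = 1%N by lia.
have /eqP/cards1P[x Dx] : #|S :\: S'| = 1%N by lia.
move: sS sS'; rewrite (big_setID S') (big_setID (A := S') S) /= [S' :&: S]setIC Dx Dy.
rewrite !big_set1 => e_x e_y; have /addrI/inj_a Exy := etrans e_x (esym e_y).
have: x \in S :\: S' by rewrite Dx set11.
have: y \in S' :\: S by rewrite Dy set11.
by rewrite Exy !inE => /andP[/negPf-> _]; rewrite andbF.
Qed.

(** Overlaps 4 and 0 would make [S'] equal to [S] or [~: S]; overlap 3 is excluded, and overlap 1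
    would be overlap 3 with the relation [~: S']. *)
Lemma card_relationI (S S' : {set 'I_8}) :
  S \in F -> S' \in F -> S' != S -> S' != ~: S -> #|S :&: S'| = 2%N.
Proof.
move=> FS FS' neS neCS.
have [cS _] := four_term_relationsP _ FS; have [cS' _] := four_term_relationsP _ FS'.
have cSC : #|~: S| = 4%N by case/four_term_relationsP: (relation_setC FS).
have n3 := card_relationI_neq3 FS FS'.
have := card_relationI_neq3 FS (relation_setC FS'); rewrite -setDE => n3'.
have := cardsID S' S; rewrite cS => cD.
have n4 : #|S :&: S'| <> 4%N.
  move=> c4; case/negP: neS; rewrite eqEcard cS cS' leqnn andbT.
  have /eqP <- : S :&: S' == S' by rewrite eqEcard subsetIr c4 cS'.
  exact: subsetIl.
have n0 : #|S :&: S'| <> 0%N.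
  move=> c0; case/negP: neCS; rewrite eqEcard cSC cS' leqnn andbT.
  by rewrite -disjoints_subset disjoint_sym -setI_eq0 -cards_eq0 c0.
lia.
Qed.

Hypothesis card_F : #|F| = 6%N.

(** Complementation exchanges the relations through [i] with those avoiding [i], so each kind makes
    up half of the six. *)
Lemma card_relations_through (i : 'I_8) : #|[set S in F | i \in S]| = 3%N.
Proof.
have := cardsID [set S : {set 'I_8} | i \in S] F; rewrite card_F.
have -> : F :\: [set S : {set 'I_8} | i \in S] = [set ~: S | S in [set S in F | i \in S]].
  apply/setP=> S; rewrite !inE; apply/idP/imsetP => [/andP[iS FS] | [S']].
    by exists (~: S); rewrite ?setCK // inE relation_setC inE // FS.
  rewrite inE => /andP[FS' iS'] ->; rewrite inE iS' /=.
  by have := relation_setC FS'; rewrite inE.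
rewrite card_imset; last exact: can_inj (@setCK _).
have -> : F :&: [set S : {set 'I_8} | i \in S] = [set S in F | i \in S].
  by apply/setP=> S; rewrite !inE.
by rewrite addnn => /(@double_inj _ 3).
Qed.

(** Each complementary pair has exactly one member through [ord0]; these three members are [A], [B],
    [C]. *)
Lemma relations_basis : exists A B C : {set 'I_8},
  [/\ [/\ A \in F, B \in F & C \in F],
      [/\ #|A :&: B| = 2%N, #|A :&: C| = 2%N & #|B :&: C| = 2%N],
      [/\ ord0 \in A, ord0 \in B & ord0 \in C] &
      forall S, S \in F -> S \in [:: A; B; C] \/ ~: S \in [:: A; B; C]].
Proof.
have := card_relations_through ord0; rewrite cardE.
have := enum_uniq [set S in F | ord0 \in S].
have := @mem_enum _ [set S in F | ord0 \in S].
case: (enum _) => [|A [|B [|C []]]] //= memF uniqF _.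
have /setIdP[FA A0] : A \in [set S in F | ord0 \in S] by rewrite -memF !inE eqxx.
have /setIdP[FB B0] : B \in [set S in F | ord0 \in S] by rewrite -memF !inE eqxx orbT.
have /setIdP[FC C0] : C \in [set S in F | ord0 \in S] by rewrite -memF !inE eqxx !orbT.
have notC (S S' : {set 'I_8}) : ord0 \in S -> ord0 \in S' -> S' != ~: S.
  by move=> S0 S'0; apply: contraTneq S'0 => ->; rewrite inE S0.
move: uniqF; rewrite !inE negb_or andbT => /andP[/andP[AB AC] BC].
exists A, B, C; split=> // [|S FS].
  by split; apply: card_relationI => //; rewrite ?notC // eq_sym.
have [S0 | S'0] := boolP (ord0 \in S); [left | right].
  by rewrite memF inE FS.
by rewrite memF inE relation_setC //= inE.
Qed.

(* The cells of A, B, C have sizes all 1, or sizes 2 and 0; in the latter case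
   the cell of ord0 is a pair with sum zero. *)
Lemma opposite_or_cube :
  (exists i j, a i + a j = 0) \/
  exists A B C : {set 'I_8},
  [/\ [/\ A \in F, B \in F & C \in F],
      forall x y z, #|in_cell A B C x y z| = 1%N &
      forall S, S \in F -> S \in [:: A; B; C] \/ ~: S \in [:: A; B; C]].
Proof.
have [A [B [C [[FA FB FC] [cAB cAC cBC] [A0 B0 C0] allF]]]] := relations_basis.
pose n x y z := #|in_cell A B C x y z|.
have [_ sA] := four_term_relationsP _ FA; have [_ sB] := four_term_relationsP _ FB.
have [_ sC] := four_term_relationsP _ FC.
have cF S : S \in F -> forall x, #|[pred i | (i \in S) == x]| = 4%N.
  move=> FS; have [cS _] := four_term_relationsP _ FS.
  have [cSC _] := four_term_relationsP _ (relation_setC FS).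
  case; [rewrite -[RHS]cS | rewrite -[RHS]cSC]; apply: eq_card => i; rewrite !inE /in_mem /=.
    by rewrite eqb_id.
  by rewrite eqbF_neg.
have DnA x : (n x true true + n x true false + (n x false true + n x false false) = 4)%N.
  by rewrite -[RHS](cF _ FA x) /n -!sum1_card; rewrite [RHS](big_cellA A B C).
have DnB y : (n true y true + n false y true + (n true y false + n false y false) = 4)%N.
  by rewrite -[RHS](cF _ FB y) /n -!sum1_card; rewrite [RHS](big_cellB A B C).
have DnC z : (n true true z + n true false z + (n false true z + n false false z) = 4)%N.
  by rewrite -[RHS](cF _ FC z) /n -!sum1_card; rewrite [RHS](big_cellC A B C).
have DAB : (n true true true + n true true false = 2)%N.
  rewrite -[RHS]cAB /n -!sum1_card -[LHS](big_cellAB A B C).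
  by apply: eq_bigl => i; rewrite inE !eqb_id.
have DAC : (n true true true + n true false true = 2)%N.
  rewrite -[RHS]cAC /n -!sum1_card -[LHS](big_cellAC A B C).
  by apply: eq_bigl => i; rewrite inE !eqb_id.
have DBC : (n true true true + n false true true = 2)%N.
  rewrite -[RHS]cBC /n -!sum1_card -[LHS](big_cellBC A B C).
  by apply: eq_bigl => i; rewrite inE !eqb_id.
have n0 : (0 < n true true true)%N.
  by apply/card_gt0P; exists ord0; apply/and3P; rewrite A0 B0 C0.
have := (DnA true, DnA false, DnB true, DnB false, DnC true, DnC false).
move=> [[[[[a1 a2] b1] b2] c1] c2].
(* With t = [n true true true], the equations give size 2 - t to the cells with one or three bits
   [false], and size t to the others. Hence t is 1 or 2. *)
have [t1 | t1] := eqVneq (n true true true) 1%N.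
  right; exists A, B, C; split=> // x y z; rewrite -/(n x y z).
  by case: x y z => [] [] []; lia.
left.
have z1 : n true true false = 0%N by lia.
have z2 : n true false true = 0%N by lia.
have z3 : n false true true = 0%N by lia.
have z4 : n false false false = 0%N by lia.
have n2 : #|[set i | in_cell A B C true true true i]| = 2%N.
  by rewrite cardsE -/(n true true true); lia.
have /eqP/cards2P[i [j [ij Dij]]] := n2.
exists i, j.
pose f x y z := \sum_(i | in_cell A B C x y z i) a i.
have f0 x y z : n x y z = 0%N -> f x y z = 0.
  by move=> /card0_eq n_0; apply: big_pred0 => k; have := n_0 k.
have fij : a i + a j = f true true true.
  have -> : f true true true = \sum_(k in [set i; j]) a k.
    by rewrite -Dij; apply: eq_bigl => k; rewrite inE.
  by rewrite big_setU1 ?inE //= big_set1.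
have eqT (S : {set 'I_8}) : \sum_(i in S) a i = \sum_(i | (i \in S) == true) a i.
  by apply: eq_bigl => k; rewrite eqb_id.
move: sA sB sC; rewrite !eqT (big_cellA A B C) (big_cellB A B C) (big_cellC A B C).
rewrite -!/(f _ _ _) (f0 _ _ _ z1) (f0 _ _ _ z2) (f0 _ _ _ z3) => sA sB sC.
have: \sum_i a i = 0 by [].
rewrite (big_split_mem _ _ A) /= (big_cellA A B C) (big_cellA A B C) -!/(f _ _ _).
rewrite (f0 _ _ _ z1) (f0 _ _ _ z2) (f0 _ _ _ z3) (f0 _ _ _ z4) => sT.
rewrite fij.
set t := f _ _ _ in sA sB sC sT *.
(* Each of [sA], [sB], [sC] equates [t] plus one remaining cell sum to 0, and [sT] adds [t] to all
   three; the sum of the first three minus [sT] is twice [t]. *)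
have: 2%:R * t = 0.
  have /= := congr2 (fun u v => u - v) (congr2 +%R (congr2 +%R sA sB) sC) sT.
  by rewrite subr0 !addr0 => <-; ring.
by move/eqP; rewrite mulf_eq0 pnatr_eq0 /= => /eqP.
Qed.

End FourTermRelations.

(** * The Galois action on the cube and the splitting of [alpha] *)

Theorem mainTheorem3 (alpha : algC) (a : 'I_8 -> algC)
    (deg_alpha : alg_degree alpha = 8%N)
    (conj_a : conjugates_of alpha a)
    (a_0 : a ord0 = alpha)
    (not_even : ~ is_even_poly (minCpoly alpha))
    (six_relations : #|four_term_relations a| = 6%N) :
  exists beta gamma : algC,
    [/\ alg_degree beta = 2%N, alg_degree gamma = 4%N & alpha = beta + gamma].
Proof.
have [inj_a root_a] := conj_a; set F := four_term_relations a in six_relations.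
have minC_a i : minCpoly (a i) = minCpoly alpha.
  have /conj_aut[nu <-] : root (minCpoly alpha) (a i) by apply/root_a; exists i.
  exact: minCpoly_aut.
have autP (nu : {rmorphism algC -> algC}) :
    exists s : 'I_8 -> 'I_8, [/\ injective s, forall i, nu (a i) = a (s i)
      & forall S, S \in F -> s @: S \in F].
  have nu_a i : exists j, a j == nu (a i).
    have /root_a[j <-] : root (minCpoly alpha) (nu (a i)); last by exists j.
    by rewrite -(minC_a i) root_minCpoly_aut.
  pose s i := xchoose (nu_a i); have Ds i : nu (a i) = a (s i).
    by rewrite (eqP (xchooseP (nu_a i))).
  have inj_s : injective s.
    by move=> i j /(congr1 a); rewrite -!Ds => /fmorph_inj/inj_a.
  exists s; split=> // S /four_term_relationsP[cS sS].
  apply/four_term_relationsP; rewrite card_imset //; split=> //.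
  rewrite big_imset /=; last by move=> i j _ _; apply: inj_s.
  rewrite -[RHS](rmorph0 nu) -[X in _ = nu X]sS rmorph_sum.
  by apply: eq_bigr => i _; rewrite Ds.
have imF (s : 'I_8 -> 'I_8) : injective s -> (forall S, S \in F -> s @: S \in F) ->
    [set s @: (S : {set 'I_8}) | S in F] = F.
  move=> inj_s Fs; apply/eqP; rewrite eqEcard card_imset ?leqnn ?andbT; last exact: imset_inj.
  by apply/subsetP=> _ /imsetP[S FS ->]; apply: Fs.
have transF i j : exists s : 'I_8 -> 'I_8,
    [/\ injective s, s i = j & forall S, S \in F -> s @: S \in F].
  have /conj_aut[nu Dnu] : root (minCpoly (a i)) (a j).
    by rewrite minC_a -(minC_a j) root_minCpoly.
  have [s [inj_s Ds Fs]] := autP nu; exists s; split=> //.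
  by apply: inj_a; rewrite -Ds.
have sum_a : \sum_i a i = 0.
  apply: trace_zero transF _ => //.
  by rewrite -cards_eq0 six_relations.
have [[i [j aij]] | [A [B [C [[FA FB FC] n1 allF]]]]] :=
    opposite_or_cube inj_a sum_a six_relations.
  case: not_even; rewrite -(minC_a i); apply: even_minCpoly.
    by rewrite /alg_degree minC_a -/(alg_degree _) deg_alpha.
  move/eqP: aij; rewrite addrC addr_eq0 => /eqP <-.
  by rewrite minC_a -(minC_a j) root_minCpoly.
(* Cells are singletons, so [f x y z] is the conjugate at that vertex; written as a sum, it fits the
   facet identities directly. *)
pose f x y z := \sum_(i | in_cell A B C x y z i) a i.
have Df i : a i = f (i \in A) (i \in B) (i \in C).
  have [k Dk] := mem_card1 (n1 (i \in A) (i \in B) (i \in C)).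
  have Dik : i = k.
    by apply/eqP; move: (Dk i); rewrite !inE => <-; apply/and3P; rewrite !eqxx.
  by rewrite /f (big_pred1 k) ?Dik // => l; move: (Dk l); rewrite -Dik.
have [k Dk] := mem_card1 (n1 (ord0 \notin A) (ord0 \notin B) (ord0 \notin C)).
(* Antipodality is expressed through all of [F], without reference to [A], [B], [C]: this form is
   preserved by automorphisms, which permute [F]. *)
have kF S : S \in F -> (k \in S) = (ord0 \notin S).
  have : k \in in_cell A B C (ord0 \notin A) (ord0 \notin B) (ord0 \notin C).
    by rewrite Dk inE.
  case/and3P=> /eqP kA /eqP kB /eqP kC.
  have kABC S' : S' \in [:: A; B; C] -> (k \in S') = (ord0 \notin S').
    by rewrite !inE => /or3P[] /eqP->.
  move/allF=> [/kABC // | /kABC]; rewrite !in_setC => /negb_inj kS.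
  by rewrite kS.
have sumF S : S \in F -> forall x, \sum_(i | (i \in S) == x) a i = 0.
  move=> FS [].
    have [_ sS] := four_term_relationsP _ _ FS.
    by rewrite -[RHS]sS; apply: eq_bigl => i; rewrite eqb_id.
  have [_ sS] := four_term_relationsP _ _ (relation_setC sum_a FS).
  by rewrite -[RHS]sS; apply: eq_bigl => i; rewrite inE eqbF_neg.
have eqA x : f x true true + f x true false + (f x false true + f x false false) = 0.
  by rewrite -[RHS](sumF _ FA x) (big_cellA A B C).
have eqB y : f true y true + f false y true + (f true y false + f false y false) = 0.
  by rewrite -[RHS](sumF _ FB y) (big_cellB A B C).
have eqC z : f true true z + f true false z + (f false true z + f false false z) = 0.
  by rewrite -[RHS](sumF _ FC z) (big_cellC A B C).
pose d x y z := f x y z - f (~~ x) (~~ y) (~~ z).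
pose g x y z := f x y z + f (~~ x) (~~ y) (~~ z).
have dN x y z : d (~~ x) (~~ y) (~~ z) = - d x y z by rewrite /d !negbK opprB.
(* The facets [A] true and [B] false share an edge; subtracting their equations cancels it and
   leaves the sum of the two diagonal differences. The next two identities are analogous. *)
have d110 : d true true false = - d true true true.
  apply/eqP; rewrite -addr_eq0 -(subrr 0) -{1}(eqA true) -(eqB false) /d /=.
  by apply/eqP; ring.
have d101 : d true false true = - d true true true.
  apply/eqP; rewrite -addr_eq0 -(subrr 0) -{1}(eqA true) -(eqC false) /d /=.
  by apply/eqP; ring.
have d011 : d false true true = - d true true true.
  apply/eqP; rewrite -addr_eq0 -(subrr 0) -{1}(eqB true) -(eqC false) /d /=.
  by apply/eqP; ring.
have dP x y z : (d x y z == d true true true) || (d x y z == - d true true true).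
  move: x y z => [] [] []; rewrite ?d110 ?d101 ?d011 ?eqxx ?orbT //.
  - by rewrite (dN false true true) d011 opprK eqxx.
  - by rewrite (dN true false true) d101 opprK eqxx.
  - by rewrite (dN true true false) d110 opprK eqxx.
  - by rewrite (dN true true true) eqxx orbT.
(* An automorphism sends the pair [ord0], [k] to another antipodal pair. *)
have orbit (nu : {rmorphism algC -> algC}) : exists x y z,
   nu (a ord0) = f x y z /\ nu (a k) = f (~~ x) (~~ y) (~~ z).
  have [s [inj_s Ds Fs]] := autP nu.
  have sk S : S \in F -> (s k \in S) = (s ord0 \notin S).
    rewrite -{1}(imF s) // => /imsetP[S' FS' ->].
    by rewrite !mem_imset // kF.
  exists (s ord0 \in A), (s ord0 \in B), (s ord0 \in C).
  by rewrite !Ds !Df !sk.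
pose h : algC := 2%:R^-1.
pose beta := (a ord0 - a k) * h; pose gamma := (a ord0 + a k) * h.
have Dalpha : alpha = beta + gamma.
  rewrite -a_0 /beta /gamma -mulrDl addrACA addNr addr0 -mulr2n -mulr_natr mulfK //.
  by rewrite pnatr_eq0.
have nu_h (nu : {rmorphism algC -> algC}) : nu h = h by rewrite fmorphV rmorph_nat.
have deg_beta : (alg_degree beta <= 2)%N.
  apply: (@alg_degree_le_orbit _ [:: d true true true * h; - d true true true * h]) => nu.
  have [x [y [z [D0 Dk']]]] := orbit nu.
  rewrite rmorphM rmorphB D0 Dk' nu_h -/(d x y z) !inE.
  by case/orP: (dP x y z) => /eqP->; rewrite eqxx ?orbT.
have deg_gamma : (alg_degree gamma <= 4)%N.
  (* One value for each diagonal, represented by its endpoint with first bit [true]; [gN] reduces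
     the other endpoints to these. *)
  apply: (@alg_degree_le_orbit _ [:: g true true true * h; g true true false * h;
     g true false true * h; g true false false * h]) => nu.
  have [x [y [z [D0 Dk']]]] := orbit nu.
  rewrite rmorphM rmorphD D0 Dk' nu_h -/(g x y z).
  have gN u v w : g (~~ u) (~~ v) (~~ w) = g u v w by rewrite /g !negbK addrC.
  rewrite !inE; case: x y z {D0 Dk'} => [] [] []; rewrite ?eqxx ?orbT // -gN eqxx ?orbT //.
exists beta, gamma; split=> //; have := alg_degree_add beta gamma; rewrite -Dalpha deg_alpha.
  by move: (alg_degree beta) (alg_degree gamma) deg_beta deg_gamma; nia.
by move: (alg_degree beta) (alg_degree gamma) deg_beta deg_gamma; nia.
Qed.
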